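(* Let $\mathbb{F}$ be a field, let $C$ be a vector space over $\mathbb{F}$, and let $A, B$ be linear subspaces of $C$. Then $A$ and $B$ are subspace-independent in $C$ if and only if $A\cap B = \{0\}$.
   Context: For subspaces $A,B$ of $C$, $A\vee B$ denotes the subspace of $C$ generated by $A\cup B$. The subspaces $A$ and $B$ are subspace-independent in $C$ if for any linear maps $\alpha: A\to A$ and $\beta: B\to B$ there is a linear map $\gamma: A\vee B\to A\vee B$ such that $\gamma(a)=\alpha(a)$ for all $a\in A$ and $\gamma(b)=\beta(b)$ for all $b\in B$. *)

(* Defs.v *)
From HB Require Import structures.
From mathcomp Require Import all_boot all_algebra.
From mathcomp Require Import boolp classical_sets.

Set Implicit Arguments.
Unset Strict Implicit.
Unset Printing Implicit Defensive.

Import GRing.Theory.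
Local Open Scope ring_scope.

(* A linear subspace is a [submodClosed C]: a boolean predicate on C containing
   0 and stable under sums and scaling.  Classically every subspace of C arises
   this way.  As for [subvs_of] in vector.v, but without any finite-dimension
   assumption, the elements of a subspace form an [lmodType]. *)
Section SubspaceType.
Variables (F : fieldType) (C : lmodType F) (A : submodClosed C).

Record subsp_of : predArgType :=
  Subsp { subsp_val :> C; subsp_valP : subsp_val \in A }.

HB.instance Definition _ := [isSub for subsp_val].
HB.instance Definition _ := [Choice of subsp_of by <:].
HB.instance Definition _ := [SubChoice_isSubLmodule of subsp_of by <:].

End SubspaceType.

Section SubspaceSpan.
Variables (F : fieldType) (C : lmodType F).

(* The subspace generated by X: the intersection of all subspaces of C that
   contain X. *)
Definition subsp_span (X : {pred C}) : {pred C} :=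
  fun x => `[< forall D : submodClosed C, {subset X <= D} -> x \in D >].

Lemma subsp_span_closed (X : {pred C}) : subsemimod_closed (subsp_span X).
Proof.
split; first split.
- by apply/asboolP => D _; apply: rpred0.
- move=> x y /asboolP Xx /asboolP Xy; apply/asboolP => D sXD.
  by apply: rpredD; [apply: Xx | apply: Xy].
- move=> a x /asboolP Xx; apply/asboolP => D sXD.
  by apply: rpredZ; apply: Xx.
Qed.

HB.instance Definition _ (X : {pred C}) :=
  GRing.isSubmodClosed.Build F C (subsp_span X) (subsp_span_closed X).

Lemma sub_subsp_span (X : {pred C}) : {subset X <= subsp_span X}.
Proof. by move=> x Xx; apply/asboolP => D; apply. Qed.

Definition subsp_join (A B : submodClosed C) : submodClosed C :=
  subsp_span [predU A & B].

Lemma subsp_joinl (A B : submodClosed C) : {subset A <= subsp_join A B}.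
Proof. by move=> x Ax; apply: sub_subsp_span; rewrite inE Ax. Qed.

Lemma subsp_joinr (A B : submodClosed C) : {subset B <= subsp_join A B}.
Proof. by move=> x Bx; apply: sub_subsp_span; rewrite inE Bx orbT. Qed.

Definition to_joinl (A B : submodClosed C) (a : subsp_of A) :
  subsp_of (subsp_join A B) := Subsp (subsp_joinl B (subsp_valP a)).

Definition to_joinr (A B : submodClosed C) (b : subsp_of B) :
  subsp_of (subsp_join A B) := Subsp (subsp_joinr A (subsp_valP b)).

(* The equations gamma(a) = alpha(a) and gamma(b) = beta(b) are between vectors
   of C. *)
Definition subspace_independent (A B : submodClosed C) : Prop :=
  forall (alpha : {linear subsp_of A -> subsp_of A})
         (beta : {linear subsp_of B -> subsp_of B}),
  exists gamma : {linear subsp_of (subsp_join A B) ->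
                         subsp_of (subsp_join A B)},
    (forall a : subsp_of A, gamma (to_joinl B a) = alpha a :> C) /\
    (forall b : subsp_of B, gamma (to_joinr A b) = beta b :> C).

End SubspaceSpan.

(* Main.v *)
From HB Require Import structures.
Require Import Defs.
From mathcomp Require Import all_boot all_algebra.
From mathcomp Require Import boolp classical_sets.

(** Extending the identity of [A] and the zero map of [B] by one map [gamma]
    forces every [c] in both [A] and [B] to satisfy [c = gamma c = 0]; this
    gives one direction.  For the other one, every vector of the join is a sum
    [a + b], because these sums already form a subspace, and the sum determines
    [a] and [b] when the intersection is trivial.  The components are therefore
    linear in the vector ([join_projections]), and composing the two projections
    with [alpha] and [beta] and adding the results gives the extension
    ([subspace_independent_of_trivial_meet]). *)

Set Implicit Arguments.
Unset Strict Implicit.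
Unset Printing Implicit Defensive.

Local Open Scope classical_set_scope.
Local Open Scope ring_scope.

Import GRing.Theory.

Section SumOfSubspaces.
Variables (F : fieldType) (C : lmodType F) (A B : submodClosed C).

Definition sum_pred : {pred C} :=
  fun x => `[< exists (a : subsp_of A) (b : subsp_of B), x = val a + val b >].

Lemma sum_pred_closed : subsemimod_closed sum_pred.
Proof.
split; first split.
- by apply/asboolP; exists 0, 0; rewrite !raddf0 addr0.
- move=> _ _ /asboolP[a [b ->]] /asboolP[a' [b' ->]]; apply/asboolP.
  by exists (a + a'), (b + b'); rewrite !raddfD addrACA.
- move=> k _ /asboolP[a [b ->]]; apply/asboolP.
  by exists (k *: a), (k *: b); rewrite !linearZ /= scalerDr.
Qed.

HB.instance Definition _ :=
  GRing.isSubmodClosed.Build F C sum_pred sum_pred_closed.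

(** The join is the least subspace containing [A] and [B], so it lies inside the
    subspace of all sums. *)
Lemma subsp_join_sum (x : subsp_of (subsp_join A B)) :
  exists ab : subsp_of A * subsp_of B, val x = val ab.1 + val ab.2.
Proof.
case: x => x /= /asboolP/(_ sum_pred) xAB.
have /asboolP[a [b ->]] : x \in sum_pred; last by exists (a, b).
apply: xAB => y /orP[Ay|By]; apply/asboolP.
- by exists (Subsp Ay), 0; rewrite raddf0 addr0.
- by exists 0, (Subsp By); rewrite raddf0 add0r.
Qed.

Lemma to_joinl_linear : linear (@to_joinl F C A B).
Proof. by move=> k a a'; apply: val_inj; rewrite [RHS]linearP. Qed.

HB.instance Definition _ := GRing.isLinear.Build F (subsp_of A)
  (subsp_of (subsp_join A B)) *:%R (@to_joinl F C A B) to_joinl_linear.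

Lemma to_joinr_linear : linear (@to_joinr F C A B).
Proof. by move=> k b b'; apply: val_inj; rewrite [RHS]linearP. Qed.

HB.instance Definition _ := GRing.isLinear.Build F (subsp_of B)
  (subsp_of (subsp_join A B)) *:%R (@to_joinr F C A B) to_joinr_linear.

(** Two decompositions of one vector differ by [val a - val a' = val b' - val b],
    which lies in both subspaces. *)
Lemma sum_inj (a a' : subsp_of A) (b b' : subsp_of B) :
  (forall x : C, x \in A -> x \in B -> x = 0) ->
  val a + val b = val a' + val b' -> a = a' /\ b = b'.
Proof.
move=> AB0 eq_ab.
have dab : val (a - a') = val (b' - b).
  by rewrite !raddfB; apply/eqP; rewrite subr_eq addrAC eq_sym subr_eq eq_ab addrC.
have a0 : val (a - a') = 0.
  by apply: AB0; [|rewrite dab]; apply: subsp_valP.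
have b0 : val (b' - b) = 0 by rewrite -dab.
split; last apply: esym; apply: subr0_eq; apply: val_inj.
  by rewrite a0 raddf0.
by rewrite b0 raddf0.
Qed.

(** A choice of components is linear as soon as components are unique: both
    sides of the linearity equation are components of the same vector. *)
Lemma join_projections :
  (forall x : C, x \in A -> x \in B -> x = 0) ->
  exists (p : {linear subsp_of (subsp_join A B) -> subsp_of A})
         (q : {linear subsp_of (subsp_join A B) -> subsp_of B}),
    forall x, val x = val (p x) + val (q x).
Proof.
move=> AB0; have [d dE] := choice subsp_join_sum.
have d_linear k x y : (d (k *: x + y)).1 = k *: (d x).1 + (d y).1 /\
                      (d (k *: x + y)).2 = k *: (d x).2 + (d y).2.
  apply: (sum_inj AB0).
  by rewrite -dE !linearP /= addrACA -scalerDr -!dE.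
pose p : {linear subsp_of (subsp_join A B) -> subsp_of A} :=
  HB.pack (fun x => (d x).1) (GRing.isLinear.Build F
    (subsp_of (subsp_join A B)) (subsp_of A) *:%R (fun x => (d x).1)
    (fun k x y => (d_linear k x y).1)).
pose q : {linear subsp_of (subsp_join A B) -> subsp_of B} :=
  HB.pack (fun x => (d x).2) (GRing.isLinear.Build F
    (subsp_of (subsp_join A B)) (subsp_of B) *:%R (fun x => (d x).2)
    (fun k x y => (d_linear k x y).2)).
by exists p, q.
Qed.

Lemma subspace_independent_of_trivial_meet :
  (forall x : C, x \in A -> x \in B -> x = 0) -> subspace_independent A B.
Proof.
move=> AB0 alpha beta; have [p [q pqE]] := join_projections AB0.
exists ((@to_joinl F C A B \o (alpha \o p)) \+
        (@to_joinr F C A B \o (beta \o q))).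
split=> [a|b] /=.
- have [] : p (to_joinl B a) = a /\ q (to_joinl B a) = 0.
    by apply: (sum_inj AB0); rewrite -pqE raddf0 addr0.
  by move=> -> ->; rewrite !raddf0 addr0.
- have [] : p (to_joinr A b) = 0 /\ q (to_joinr A b) = b.
    by apply: (sum_inj AB0); rewrite -pqE raddf0 add0r.
  by move=> -> ->; rewrite !raddf0 add0r.
Qed.

Lemma trivial_meet_of_subspace_independent :
  subspace_independent A B -> forall x : C, x \in A -> x \in B -> x = 0.
Proof.
move=> indAB x Ax Bx; have [gamma [gA gB]] := indAB idfun \0.
have := gA (Subsp Ax).
(* The two copies of [x] are the same vector of the join. *)
have -> : to_joinl B (Subsp Ax) = to_joinr A (Subsp Bx) by apply: val_inj.
by rewrite gB.
Qed.

End SumOfSubspaces.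

Theorem proposition2p7 (F : fieldType) (C : lmodType F) (A B : submodClosed C) :
  subspace_independent A B <->
  [set x : C | x \in A] `&` [set x : C | x \in B] = [set 0].
Proof.
split=> [indAB | AB0].
- apply/seteqP; split=> x /=.
    by case; apply: trivial_meet_of_subspace_independent.
  by move=> ->; split; apply: rpred0.
- apply: subspace_independent_of_trivial_meet => x Ax Bx.
  by have : [set 0] x by rewrite -AB0.
Qed.
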